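(* Let $k\ge1$ be an integer and let $H$ be a finite graph that contains a $k$-matching. Then, for $p\in(0,1)$, \[ f(H,p)=\Omega_H\left(p^{-(e(H)-k(k-1))/(v(H)-k)}\right), \] where the implicit positive constant depends only on $H$.
   Context: A graph has a $k$-matching if it contains $k$ vertex-disjoint edges. $v(H)$ and $e(H)$ denote the numbers of vertices and edges of $H$. In the Subgraph Query Game with parameter $p\in(0,1)$, Builder plays alone on the random graph $G(\mathbb Z,p)$ with infinitely many vertices, whose edges are initially hidden. At each turn Builder queries (adaptively) one pair of vertices and is told whether it is an edge; equivalently, each queried edge is built successfully, independently, with probability $p$, and each pair may be queried at most once. $f(H,p)$ is the minimum, over all Builder strategies, of the number of turns needed to build a copy of $H$ with probability at least $\frac12$. *)

(* Defs.v *)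
From HB Require Import structures.
From mathcomp Require Import all_boot all_order all_algebra.
From mathcomp Require Import all_classical all_reals all_analysis.

Set Implicit Arguments.
Unset Strict Implicit.
Unset Printing Implicit Defensive.

Import Order.TTheory GRing.Theory Num.Theory.
Local Open Scope ring_scope.

Record simple_graph := SimpleGraph {
  vertex :> finType;
  adj : rel vertex;
  adj_sym : symmetric adj;
  adj_irr : irreflexive adj
}.

Definition edges (H : simple_graph) : {set {set H}} :=
  [set A : {set H} | [exists x, exists y, adj x y && (A == [set x; y]%SET)]]%SET.

Definition has_matching (H : simple_graph) (k : nat) : Prop :=
  exists M : {set {set H}}, [/\ M \subset edges H, finset.trivIset M & #|M| = k].

(* The unordered pair of distinct integers {x, y} is represented by (x, y)
   with x < y. *)
Definition pair_query : Type := (int * int)%type.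

(* An adaptive strategy: the next query as a function of the answers received
   so far, in chronological order (true = the queried pair is an edge). The
   earlier queries are themselves determined by these answers. *)
Definition strategy : Type := seq bool -> pair_query.

Definition queries (s : strategy) (w : seq bool) : seq pair_query :=
  [seq s (take i w) | i <- iota 0 (size w)].

Definition legal (s : strategy) : Prop :=
  forall w : seq bool,
    uniq (queries s w) /\ all (fun q : pair_query => q.1 < q.2) (queries s w).

Definition built (s : strategy) (w : seq bool) : seq pair_query :=
  mask w (queries s w).

Definition has_copy (H : simple_graph) (E : seq pair_query) : Prop :=
  exists f : H -> int, injective f /\
    forall x y : H, adj x y -> ((f x, f y) \in E) || ((f y, f x) \in E).

(* The answers to the first t queries are independent Bernoulli(p) variables,
   whatever the (legal) strategy. *)
Definition win_prob (R : realType) (H : simple_graph) (p : R)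
    (s : strategy) (t : nat) : R :=
  \sum_(w : t.-tuple bool | `[< has_copy H (built s w) >])
    \prod_(b <- w) (if b then p else 1 - p).

(* f(H, p); the infimum is over a set of natural numbers, hence a minimum. *)
Definition query_number (R : realType) (H : simple_graph) (p : R) : \bar R :=
  ereal_inf [set t%:R%:E | t in
    [set t : nat | exists s : strategy, legal s /\ 1 / 2 <= win_prob H p s t]]%classic.

(* Main.v *)
Require Import Defs.
From HB Require Import structures.
From mathcomp Require Import all_boot all_order all_algebra.
From mathcomp Require Import all_classical all_reals all_analysis.
From mathcomp Require Import perm zify.

(** Union bound over encodings of the possible copies of [H]. Fix a copy built
   within [N] queries. Among its [k]-matchings take one minimising the sum of
   [2 ^ t], [t] the query times of its edges. Locate each matched vertex by the
   query time of its matching edge, and every other vertex by the time of the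
   first query of the copy that contains it: this takes at most [v(H) - k]
   times, hence [O_H(N ^ (v(H) - k))] encodings. An edge queried no earlier than
   the times locating its two ends is recognised before its answer is known, so
   [j] such edges all succeed with probability at most [p ^ j]. By minimality
   (exchange one end of a matching edge for an unmatched neighbour, or re-pair
   two matching edges), the only other edges join two matching edges, and each
   of the two ways of re-pairing these contains at most one of them: there are
   at most [2 * 'C(k, 2) = k (k - 1)]. *)

Set Implicit Arguments.
Unset Strict Implicit.
Unset Printing Implicit Defensive.

Import Order.TTheory GRing.Theory Num.Theory.
Local Open Scope ring_scope.

(** * Predictable successes among Bernoulli answers *)

Lemma sum_tuple_cons (V : nmodType) (N : nat) (F : seq bool -> V) :
  \sum_(w : N.+1.-tuple bool) F w =
  \sum_(w : N.-tuple bool) F (true :: w) +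
  \sum_(w : N.-tuple bool) F (false :: w).
Proof.
rewrite (reindex (fun bw : bool * N.-tuple bool => cons_tuple bw.1 bw.2)) /=.
  by rewrite -(pair_bigA _ (fun b (w : N.-tuple bool) => F (b :: w))) big_bool.
exists (fun w => (thead w, behead_tuple w)) => [[b w] _|w _] /=.
  by congr (_, _); apply: val_inj.
by apply: val_inj; case/tupleP: w => b w; rewrite /= theadE.
Qed.

Definition bern_weight (R : realType) (p : R) (w : seq bool) : R :=
  \prod_(b <- w) (if b then p else 1 - p).

Lemma bern_weight_ge0 (R : realType) (p : R) (w : seq bool) :
  0 <= p <= 1 -> 0 <= bern_weight p w.
Proof.
by case/andP=> p0 p1; apply: prodr_ge0 => -[] _; rewrite ?subr_ge0.
Qed.

(* [req u] is read off the past answers [u] and singles out the next query as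
   one that has to succeed; such a query costs a factor [p] whatever the past. *)
Lemma predictable_success_le (R : realType) (p : R) (req : pred (seq bool))
    (N m : nat) (u : seq bool) : 0 <= p <= 1 ->
  \sum_(w : N.-tuple bool
        | [forall i : 'I_N, req (u ++ take i w) ==> nth false w i]
          && (m <= \sum_(i < N) req (u ++ take i w))%N)
     bern_weight p w <= p ^+ m.
Proof.
move=> p01; have /andP[p0 p1] := p01.
pose G N u m (w : seq bool) :=
  [forall i : 'I_N, req (u ++ take i w) ==> nth false w i]
  && (m <= \sum_(i < N) req (u ++ take i w))%N.
rewrite big_mkcond /=.
pose F u m N w := if G N u m w then bern_weight p w else 0.
rewrite -/(\sum_(w : N.-tuple bool) F u m N w).
elim: N m u => [|N IHN] m u.
  rewrite (eq_bigr (fun=> F u m 0%N [::])); last by move=> w _; rewrite tuple0.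
  rewrite sumr_const card_tuple expn0 mulr1n /F /G /bern_weight big_ord0 big_nil.
  rewrite leqn0; case: m => [|m] /=; last by rewrite andbF exprn_ge0.
  by rewrite expr0; case: ifP.
rewrite sum_tuple_cons.
(* Peeling off the first answer: a required one must be [true] and lowers the demand to [m.-1]; any
   other leaves [m] as it is. *)
have GS b w : G N.+1 u m (b :: w) =
    if req u then b && G N (rcons u b) m.-1 w else G N (rcons u b) m w.
  rewrite /G big_ord_recl /= cats0.
  have -> : [forall i : 'I_N.+1, req (u ++ take i (b :: w)) ==>
                 nth false (b :: w) i] =
      (req u ==> b) &&
      [forall i : 'I_N, req (rcons u b ++ take i w) ==> nth false w i].
    apply/forallP/andP => [h|[h0 /forallP h] i].
      split; first by have := h ord0; rewrite /= cats0.
      by apply/forallP => i; have := h (lift ord0 i); rewrite /= cat_rcons.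
    have [->|[j ->]] : i = ord0 \/ exists j, i = lift ord0 j.
      by case: (unliftP ord0 i) => [j ->|->]; [right; exists j|left].
      by rewrite /= cats0.
    by have := h j; rewrite /= cat_rcons.
  under eq_bigr do rewrite -cat_rcons.
  case: (req u) => //=; rewrite -andbA; congr (_ && (_ && _)).
  by case: m.
have FS b w : F u m N.+1 (b :: w) = (if b then p else 1 - p) *
    (if req u then (if b then F (rcons u b) m.-1 N w else 0)
     else F (rcons u b) m N w).
  rewrite /F GS /bern_weight big_cons.
  by case: (req u); case: b; case: (G _ _ _ w); rewrite ?mulr0.
under eq_bigr do rewrite FS.
under [X in _ + X]eq_bigr do rewrite FS.
rewrite -!mulr_sumr; case: (req u).
  rewrite [X in _ + _ * X]big1 // mulr0 addr0.
  (* At [m = 0] the predecessor stays 0, and the bound reduces to [p <= 1]. *)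
  apply: (@le_trans _ _ (p * p ^+ m.-1)); first exact: ler_wpM2l.
  by case: (m) => [|m'] /=; rewrite ?expr0 ?mulr1 // exprS.
apply: (@le_trans _ _ (p * p ^+ m + (1 - p) * p ^+ m)); last first.
  by rewrite -mulrDl addrC subrK mul1r.
by apply: lerD; apply: ler_wpM2l => //; rewrite subr_ge0.
Qed.

(** * Legal strategies and the event attached to an encoding *)

Lemma legal_inj (s : strategy) (w : seq bool) (i j : nat) :
  legal s -> (i < size w)%N -> (j < size w)%N ->
  s (take i w) = s (take j w) -> i = j.
Proof.
move=> /(_ w)[un _] iN jN e.
have nthE l : (l < size w)%N -> nth (0, 0) (queries s w) l = s (take l w).
  by move=> lN; rewrite (nth_map 0%N) ?size_iota // nth_iota.
by apply/eqP; rewrite -(nth_uniq (0, 0) _ _ un) ?size_map ?size_iota // !nthE // e.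
Qed.

Lemma legal_lt (s : strategy) (w : seq bool) : legal s -> (s w).1 < (s w).2.
Proof.
move=> /(_ (rcons w true))[_ /allP]; apply; apply/mapP; exists (size w).
  by rewrite mem_iota size_rcons /=.
by rewrite -cats1 take_size_cat.
Qed.

Section CodeEvent.
Variables (H : simple_graph) (s : strategy) (N : nat).
Variables (tau : H -> nat) (sigma : H -> bool) (C : {set {set H}}).

(** Decoding of a location; it uses only the answers before time [tau x]. *)
Definition vertex_image (w : seq bool) (x : H) : int :=
  let q := s (take (tau x) w) in if sigma x then q.1 else q.2.

(** The bounds on [tau] let query [i] be compared with the image of [A] before its answer is known.
    Queries are ordered pairs, so both orders of the ends are tried. *)
Definition asked (w : seq bool) (i : nat) (A : {set H}) :=
  [exists x, exists y, [&& A == [set x; y]%SET, (tau x <= i)%N, (tau y <= i)%N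
                         & s (take i w) == (vertex_image w x, vertex_image w y)]].

(** Injectivity on the ends of [C] belongs to the event so that distinct edges of [C] are asked at
    distinct times. *)
Definition code_event (w : seq bool) :=
  [forall A in C, forall B in C, forall x in A, forall y in B,
     (vertex_image w x == vertex_image w y) ==> (x == y)] &&
  [forall A in C, [exists i : 'I_N, nth false w i && asked w i A]].

Lemma askedP w i A : reflect
  (exists x y, [/\ A = [set x; y]%SET, (tau x <= i)%N, (tau y <= i)%N
                 & s (take i w) = (vertex_image w x, vertex_image w y)]) (asked w i A).
Proof.
apply: (iffP existsP) => [[x /existsP[y /and4P[/eqP ? ? ? /eqP ?]]]|].
  by exists x, y.
move=> [x [y [-> ? ? ?]]]; exists x; apply/existsP; exists y.
by apply/and4P; split=> //; apply/eqP.
Qed.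

Lemma asked_take w i A : asked (take i w) i A = asked w i A.
Proof.
apply: eq_existsb => x; apply: eq_existsb => y.
rewrite /vertex_image take_takel //.
case xi: (tau x <= i)%N; rewrite ?andbF //.
case yi: (tau y <= i)%N; rewrite ?andbF //.
by rewrite !take_takel.
Qed.

(** Call a query required if it asks for some [A] in [C], which the past decides by [asked_take].
    Inside the event all required queries succeed and there are at least [#|C|] of them, so
    [predictable_success_le] applies. *)
Lemma code_event_prob (R : realType) (p : R) : 0 <= p <= 1 -> legal s ->
  \sum_(w : N.-tuple bool | code_event w) bern_weight p w <= p ^+ #|C|.
Proof.
move=> p01 sl.
pose req (u : seq bool) := [exists A in C, asked u (size u) A].
have reqE (w : N.-tuple bool) (i : 'I_N) :
    req ([::] ++ take i w) = [exists A in C, asked w i A].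
  rewrite /= /req size_take size_tuple ltn_ord.
  by apply: eq_existsb => A; rewrite asked_take.
apply: le_trans (predictable_success_le req N #|C| [::] p01).
rewrite big_mkcond [leRHS]big_mkcond /=; apply: ler_sum => w _.
case: ifP => [|_]; last by case: ifP => _; rewrite ?bern_weight_ge0.
move=> /andP[/forall_inP inj /forall_inP ev].
have {}inj A B x y : A \in C -> B \in C -> x \in A -> y \in B ->
    vertex_image w x = vertex_image w y -> x = y.
  move=> AC BC xA yB e.
  have /forall_inP/(_ _ BC)/forall_inP/(_ _ xA)/forall_inP/(_ _ yB) := inj _ AC.
  by rewrite e eqxx => /eqP.
(* By legality the pair of [A] is queried only once, so a required query for [A] is the successful
   one granted by the event. *)
have -> : [forall i : 'I_N, req ([::] ++ take i w) ==> nth false w i].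
  apply/forallP => i; apply/implyP; rewrite reqE.
  move=> /exists_inP[A AC /askedP[x [y [AE _ _ qi]]]].
  have /existsP[j /andP[wj /askedP[x' [y' [AE' _ _ qj]]]]] := ev _ AC.
  suff -> : i = j by [].
  apply: val_inj; apply: (legal_inj sl (w := w)); rewrite ?size_tuple ?ltn_ord //.
  rewrite qi qj; have := set21 x y; have := set22 x y; rewrite -AE AE' !inE.
  have lti := legal_lt (take i w) sl; have ltj := legal_lt (take j w) sl.
  move: lti ltj; rewrite qi qj /= => lti ltj.
  (* Swapped ends are impossible, since queries list the smaller integer first. *)
  case/orP=> /eqP ey /orP[] /eqP ex; rewrite ex ey // in lti *.
  - by rewrite ltxx in lti.
  - by have := lt_trans lti ltj; rewrite ltxx.
  - by rewrite ltxx in lti.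
suff -> : (#|C| <= \sum_(i < N) req ([::] ++ take i w))%N by [].
have [->|[A0 A0C]] := set_0Vmem C; first by rewrite cards0.
(* A nonempty [C] provides a time, the default value of [f] outside [C]. *)
have [i0 _] := existsP (ev _ A0C).
have /choice[f fP] A : exists i : 'I_N, A \in C -> asked w i A.
  case AC: (A \in C); last by exists i0.
  by have /existsP[i /andP[_ ?]] := ev _ AC; exists i.
under eq_bigr do rewrite reqE.
rewrite -big_mkcond /= sum1_card.
have finj : {in C &, injective f}.
  move=> A B AC BC fAB.
  have /askedP[x [y [AE _ _ qA]]] := fP _ AC.
  have /askedP[x' [y' [BE _ _ ]]] := fP _ BC.
  rewrite -fAB qA AE BE => -[ex ey].
  have -> : x = x' by apply: (inj A B) => //; rewrite (AE, BE) !inE eqxx ?orbT.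
  have -> : y = y' by apply: (inj A B) => //; rewrite (AE, BE) !inE eqxx ?orbT.
  by [].
rewrite -(card_in_imset finj); apply/subset_leq_card/fintype.subsetP => i.
case/imsetP => A AC ->; rewrite unfold_in /=.
by apply/exists_inP; exists A => //; apply: fP.
Qed.
End CodeEvent.

(** * Matchings and exchanges *)

Lemma edgesP (H : simple_graph) (A : {set H}) :
  reflect (exists x y, adj x y /\ A = [set x; y]%SET) (A \in edges H).
Proof.
rewrite inE; apply: (iffP existsP) => [[x /existsP[y /andP[xy /eqP ->]]]|].
  by exists x, y.
by move=> [x [y [xy ->]]]; exists x; apply/existsP; exists y; rewrite xy eqxx.
Qed.

Definition matching (H : simple_graph) (k : nat) (m : {ffun 'I_k * bool -> H}) :=
  injectiveb m && [forall i, adj (m (i, true)) (m (i, false))].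

Definition medge (H : simple_graph) (k : nat) (m : {ffun 'I_k * bool -> H}) i :=
  [set m (i, true); m (i, false)]%SET.

Lemma has_matchingP (H : simple_graph) (k : nat) :
  has_matching H k -> exists m : {ffun 'I_k * bool -> H}, matching m.
Proof.
move=> [M [/fintype.subsetP Medges Mtriv cardM]].
have /choice[e eP] (i : 'I_#|M|) : exists xy : H * H,
    adj xy.1 xy.2 /\ enum_val i = [set xy.1; xy.2]%SET.
  by have /edgesP[x [y ?]] := Medges _ (enum_valP i); exists (x, y).
rewrite -cardM.
pose m := [ffun ib : 'I_#|M| * bool => if ib.2 then (e ib.1).1 else (e ib.1).2].
exists m; apply/andP; split; last by apply/forallP => i; rewrite !ffunE (eP i).1.
have m_in ib : m ib \in enum_val ib.1.
  by rewrite (eP ib.1).2 ffunE; case: ib.2; rewrite !inE eqxx ?orbT.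
apply/injectiveP => -[i b] [j c] mij.
have ij : i = j.
  apply/eqP; rewrite -(inj_eq enum_val_inj); apply/contraT => neq.
  have := disjointFr (elimT finset.trivIsetP Mtriv _ _ (enum_valP i) (enum_valP j) neq)
             (m_in (i, b)).
  by rewrite mij m_in.
rewrite -{j}ij in mij *; congr pair; move: mij; rewrite !ffunE /=.
have [ei _] := eP i.
by case: b c => [] [] //= eii; move: ei; rewrite eii adj_irr.
Qed.

Lemma matching_adj (H : simple_graph) k (m : {ffun 'I_k * bool -> H}) i b :
  matching m -> adj (m (i, b)) (m (i, ~~ b)).
Proof. by case/andP=> _ /forallP/(_ i); case: b; rewrite //= adj_sym. Qed.

Lemma medgeE (H : simple_graph) k (m : {ffun 'I_k * bool -> H}) i b :
  medge m i = [set m (i, b); m (i, ~~ b)]%SET.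
Proof. by case: b; rewrite // /medge finset.setUC. Qed.

Lemma medge_edges (H : simple_graph) k (m : {ffun 'I_k * bool -> H}) i :
  matching m -> medge m i \in edges H.
Proof.
by move/(matching_adj i true) => a; apply/edgesP; exists (m (i, true)), (m (i, false)).
Qed.

(** If [maxn c d] were smaller, [2 ^ c] and [2 ^ d] would each be at most half of [2 ^ maxn a b],
    which is less than [2 ^ a + 2 ^ b]. *)
Lemma exp2_maxn_le (a b c d : nat) :
  (2 ^ a + 2 ^ b <= 2 ^ c + 2 ^ d -> maxn a b <= maxn c d)%N.
Proof.
move=> h; rewrite leqNgt; apply/negP => lt.
have lt_c : (2 ^ c.+1 <= 2 ^ maxn a b)%N.
  by rewrite leq_exp2l // (leq_ltn_trans _ lt) // leq_maxl.
have lt_d : (2 ^ d.+1 <= 2 ^ maxn a b)%N.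
  by rewrite leq_exp2l // (leq_ltn_trans _ lt) // leq_maxr.
have lt_ab : (2 ^ maxn a b < 2 ^ a + 2 ^ b)%N.
  have a0 : (0 < 2 ^ a)%N by rewrite expn_gt0.
  have b0 : (0 < 2 ^ b)%N by rewrite expn_gt0.
  by case: (leqP a b) => _; rewrite -subn_gt0 ?addnK ?addKn.
move: lt_c lt_d lt_ab h; rewrite !expnS; lia.
Qed.

(* With weights [2 ^ T], the latest edge alone decides every exchange. *)
Lemma min_weight_matching (H : simple_graph) k (T : {set H} -> nat) :
  has_matching H k -> exists m : {ffun 'I_k * bool -> H},
  [/\ matching m,
      forall i b x, (forall z, m z != x) -> adj (m (i, b)) x ->
        (T (medge m i) <= T [set m (i, b); x]%SET)%N &
      forall i j b c, i != j -> adj (m (i, b)) (m (j, c)) ->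
        adj (m (i, ~~ b)) (m (j, ~~ c)) ->
        (maxn (T (medge m i)) (T (medge m j)) <=
         maxn (T [set m (i, b); m (j, c)]%SET)
              (T [set m (i, ~~ b); m (j, ~~ c)]%SET))%N].
Proof.
move=> /has_matchingP[m0 m0P].
pose W (m : {ffun 'I_k * bool -> H}) := (\sum_i 2 ^ T (medge m i))%N.
case: (@arg_minnP _ m0 _ W m0P) => m mP mmin; exists m.
have /andP[/injectiveP minj /forallP madj] := mP.
split=> // [i b x xm axm|i j b c ij a1 a2].
- pose m' := [ffun z => if z == (i, ~~ b) then x else m z].
  have m'ib : m' (i, b) = m (i, b).
    by rewrite ffunE xpair_eqE eqxx; case: (b).
  have m'ixb : m' (i, ~~ b) = x by rewrite ffunE eqxx.
  have m'j j d : j != i -> m' (j, d) = m (j, d).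
    by move=> ji; rewrite ffunE xpair_eqE (negPf ji).
  have m'P : matching m'.
    apply/andP; split.
      apply/injectiveP => y z; rewrite !ffunE.
      case: eqP => [->|_]; case: eqP => [->|_] // e.
      - by have := xm z; rewrite -e eqxx.
      - by have := xm y; rewrite e eqxx.
      - exact: minj.
    apply/forallP => j; have [->|ji] := eqVneq j i; last by rewrite !m'j.
    case: (b) m'ib m'ixb axm => /= -> ->; by rewrite // adj_sym.
  have := mmin _ m'P; rewrite /W (bigD1 i) //= [X in (_ <= X)%N](bigD1 i) //=.
  under [X in (_ <= _ + X)%N]eq_bigr do rewrite /medge !m'j //.
  by rewrite leq_add2r leq_exp2l // (medgeE m' i b) m'ib m'ixb.
(* This transposition joins [m (i, b)] to [m (j, c)] and [m (i, ~~ b)] to [m (j, ~~ c)]. *)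
- pose m' := [ffun z => m (tperm (i, ~~ b) (j, c) z)].
  have ji : j != i by rewrite eq_sym.
  have m'ib : m' (i, b) = m (i, b).
    by rewrite ffunE tpermD // xpair_eqE ?(negPf ji) // eqxx; case: (b).
  have m'ixb : m' (i, ~~ b) = m (j, c) by rewrite ffunE tpermL.
  have m'jc : m' (j, c) = m (i, ~~ b) by rewrite ffunE tpermR.
  have m'jxc : m' (j, ~~ c) = m (j, ~~ c).
    by rewrite ffunE tpermD // xpair_eqE ?(negPf ij) // eqxx; case: (c).
  have m'l l d : l != i -> l != j -> m' (l, d) = m (l, d).
    by move=> li lj; rewrite ffunE tpermD // xpair_eqE eq_sym
      ?(negPf li) ?(negPf lj).
  have m'P : matching m'.
    apply/andP; split.
      by apply/injectiveP => y z; rewrite !ffunE => /minj/perm_inj.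
    apply/forallP => l; have [->|li] := eqVneq l i.
      by case: (b) m'ib m'ixb a1 => /= -> ->; rewrite // adj_sym.
    have [->|lj] := eqVneq l j; last by rewrite !m'l.
    by case: (c) m'jc m'jxc a2 => /= -> ->; rewrite // adj_sym.
  have := mmin _ m'P; rewrite /W (bigD1 i) //= [X in (_ <= X)%N](bigD1 i) //=.
  rewrite (bigD1 j) //= [X in (_ <= _ + X)%N](bigD1 j) //= !addnA.
  under [X in (_ <= _ + X)%N]eq_bigr => l /andP[li lj] do rewrite /medge !m'l //.
  rewrite leq_add2r (medgeE m' i b) (medgeE m' j c) m'ib m'ixb m'jc m'jxc.
  exact: exp2_maxn_le.
Qed.

(** * Counting the edges queried no earlier than their ends are located *)

Definition counted (H : simple_graph) (T : {set H} -> nat) (tau : H -> nat) :=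
  [set A in edges H | [forall x in A, (tau x <= T A)%N]]%SET.

(* Here [T] is the query time of an edge and [tau] the time locating a vertex.
   Each ordered pair of distinct matching edges accounts for one of the two ways
   of re-pairing them, hence for at most one uncounted edge. *)
Lemma card_counted (H : simple_graph) k (T : {set H} -> nat) (tau : H -> nat)
    (m : {ffun 'I_k * bool -> H}) :
  matching m ->
  (forall i b x, (forall z, m z != x) -> adj (m (i, b)) x ->
     (T (medge m i) <= T [set m (i, b); x]%SET)%N) ->
  (forall i j b c, i != j -> adj (m (i, b)) (m (j, c)) ->
     adj (m (i, ~~ b)) (m (j, ~~ c)) ->
     (maxn (T (medge m i)) (T (medge m j)) <=
      maxn (T [set m (i, b); m (j, c)]%SET)
           (T [set m (i, ~~ b); m (j, ~~ c)]%SET))%N) ->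
  (forall i b, tau (m (i, b)) = T (medge m i)) ->
  (forall x, (forall z, m z != x) -> forall y, adj x y ->
     (tau x <= T [set x; y]%SET)%N) ->
  (#|edges H| - k * k.-1 <= #|counted T tau|)%N.
Proof.
move=> mP swap1 swap2 tau_m tau_x.
pose L := edges H :\: counted T tau.
suff cL : (#|L| <= k * k.-1)%N.
  have := cardsID (counted T tau) (edges H); rewrite -/L.
  have : (#|edges H :&: counted T tau| <= #|counted T tau|)%N.
    exact/subset_leq_card/finset.subsetIr.
  lia.
have LP x y : [set x; y]%SET \in L ->
    adj x y /\ (T [set x; y]%SET < maxn (tau x) (tau y))%N.
  rewrite finset.in_setD => /andP[+ xyE].
  rewrite /counted finset.in_set xyE /= => /forall_inPn[z].
  have xy : adj x y.
    move/edgesP: xyE => [x' [y' [xy' e]]].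
    have := set21 x y; have := set22 x y; rewrite e !inE.
    case/orP=> /eqP ey /orP[] /eqP ex; rewrite ex ey // 1?adj_sym //.
      have := set22 x' y'; rewrite -e ex ey !inE orbb => /eqP yx.
      by rewrite yx adj_irr in xy'.
    have := set21 x' y'; rewrite -e ex ey !inE orbb => /eqP yx.
    by rewrite yx adj_irr in xy'.
  rewrite !inE -ltnNge => /orP[] /eqP -> lt; split=> //.
    by rewrite (leq_trans lt) // leq_maxl.
  by rewrite (leq_trans lt) // leq_maxr.
(* The order of [i] and [j] selects the re-pairing: crossing ([b] with [~~ b]) if [i < j], parallel
   ([b] with [b]) otherwise. Then [b] selects one of its two edges. *)
pose e (ij : 'I_k * 'I_k) b : {set H} :=
  [set m (ij.1, b); m (ij.2, b (+) (ij.1 < ij.2)%N)]%SET.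
pose D : {set 'I_k * 'I_k} := [set ij | ij.1 != ij.2]%SET.
pose psi ij := if e ij true \in L then e ij true else e ij false.
have cardD : #|D| = (k * k.-1)%N.
  have := cardsC [set (i, i) | i : 'I_k]%SET.
  rewrite card_imset => [|i j [] //]; rewrite card_prod !card_ord.
  have -> : (~: [set (i, i) | i : 'I_k])%SET = D.
    apply/setP => -[i j]; rewrite finset.in_setC finset.in_set /=; congr negb.
    by apply/imsetP/eqP => [[l _ [-> ->]] //|->]; exists j.
  by rewrite -subn1 mulnBr muln1 => <-; rewrite addKn.
rewrite -cardD; apply: leq_trans (leq_imset_card psi D).
apply/subset_leq_card/fintype.subsetP => A AL.
suff [ij [b [ijD Ae]]] : exists ij b, ij \in D /\ A = e ij b.
  apply/imsetP; exists ij => //; rewrite /psi.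
  case: ifPn => [eL|]; last by rewrite Ae in AL; case: (b) AL Ae => // ->.
  (* Here both edges of one re-pairing would be uncounted, hence queried before the later of the two
     matching edges, against [swap2]. *)
  case: b Ae => // Ae; exfalso.
  rewrite Ae in AL; have [a1 l1] := LP _ _ AL; have [a2 l2] := LP _ _ eL.
  rewrite inE in ijD.
  move: a1 l1 a2 l2; rewrite !tau_m.
  case: (_ < _)%N => /= a1 l1 a2 l2.
    by have := swap2 _ _ _ _ ijD a2 a1; rewrite leqNgt gtn_max /= l1 l2.
  by have := swap2 _ _ _ _ ijD a2 a1; rewrite leqNgt gtn_max /= l1 l2.
have [x [y [xy Axy]]] : exists x y, adj x y /\ A = [set x; y]%SET.
  by apply: (elimT (edgesP _)); move: AL; rewrite finset.in_setD => /andP[].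
rewrite Axy in AL *; have [_ lt] := LP _ _ AL.
have mem z : (exists i b, z = m (i, b)) \/ forall i, m i != z.
  have [/codomP[[i b] zE]|nz] := boolP (z \in codom m).
    by left; exists i, b.
  by right=> i; apply: contraNneq nz => <-; apply: codom_f.
have sw1 i b z : (forall i, m i != z) -> adj (m (i, b)) z ->
    (tau (m (i, b)) <= T [set m (i, b); z]%SET)%N.
  by move=> zP a; rewrite tau_m; apply: swap1.
(* An unmatched end is located in time by [tau_x], and a matched end facing it by [swap1]. So both
   ends of an uncounted edge are matched, by different matching edges. *)
case: (mem x) (mem y) => [[i [b xE]]|xm] [[j [c yE]]|ym].
- rewrite xE yE in xy lt *.
  have ij : i != j.
    apply/eqP => ij; rewrite -ij in xy lt *.
    have cb : c = ~~ b by move: xy; case: (b) (c) => [] []; rewrite ?adj_irr.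
    by move: lt; rewrite cb !tau_m maxnn -medgeE ltnn.
  have [bc|bc] := eqVneq b c.
    have [lt_ij|le_ji] := ltnP i j.
      exists (j, i), b; split; first by rewrite inE eq_sym.
      by rewrite /e /= ltnNge ltnW //= addbF finset.setUC bc.
    exists (i, j), b; split; first by rewrite inE.
    by rewrite /e /= ltnNge le_ji addbF bc.
  have cb : c = ~~ b by case: (b) (c) bc => [] [].
  have [lt_ij|le_ji] := ltnP i j.
    exists (i, j), b; split; first by rewrite inE.
    by rewrite /e /= lt_ij addbT cb.
  exists (j, i), c; split; first by rewrite inE eq_sym.
  rewrite /e /= ltn_neqAle le_ji andbT eq_sym.
  by rewrite -(inj_eq val_inj) in ij; rewrite ij addbT cb negbK finset.setUC.
- move: lt; rewrite xE leq_max !ltnNge sw1 -?xE //= finset.setUC.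
  by rewrite tau_x // adj_sym.
- move: lt; rewrite yE leq_max !ltnNge tau_x -?yE //= yE finset.setUC.
  by rewrite sw1 -?yE // adj_sym.
- move: lt; rewrite leq_max !ltnNge tau_x //= finset.setUC.
  by rewrite tau_x // adj_sym.
Qed.

(** * Encoding a copy *)

Lemma built_query (s : strategy) (w : seq bool) q : q \in built s w ->
  exists2 i, (i < size w)%N & nth false w i /\ s (take i w) = q.
Proof.
rewrite /built /queries -map_mask -[X in mask X](mkseq_nth false) -filter_mask.
case/mapP => i; rewrite mem_filter mem_iota => /andP[wi /andP[_ iw]] ->.
by exists i.
Qed.

(** Splits the location times into [d] values and a labelling of the vertices, so that the number of
    time functions grows only like [N ^ d]. *)
Lemma factor_card (aT rT : finType) (y0 : rT) (d : nat) (f : aT -> rT) :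
  (#|f @: [set: aT]| <= d)%N ->
  exists (r : {ffun aT -> 'I_d}) (g : {ffun 'I_d -> rT}), forall x, g (r x) = f x.
Proof.
set S := f @: _ => Sd.
have fS x : f x \in S by apply: imset_f; rewrite finset.in_setT.
exists [ffun x => widen_ord Sd (enum_rank_in (fS x) (f x))].
exists [ffun i => nth y0 (enum S) (val i)] => x.
by rewrite !ffunE /= -(enum_val_nth y0) enum_rankK_in.
Qed.

Lemma matching_card (H : simple_graph) k (m : {ffun 'I_k * bool -> H}) :
  matching m -> (k * 2 <= #|H|)%N.
Proof.
by case/andP=> /injectiveP/leq_card; rewrite card_prod card_ord card_bool.
Qed.

Lemma matching_imset_card (H : simple_graph) k (m : {ffun 'I_k * bool -> H})
    (rT : finType) (f : H -> rT) :
  matching m -> (forall i, f (m (i, true)) = f (m (i, false))) ->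
  (#|f @: [set: H]| <= #|H| - k)%N.
Proof.
move=> /andP[/injectiveP minj _] fm.
pose B := [set m (i, true) | i : 'I_k]%SET.
have cB : #|B| = k by rewrite card_imset ?card_ord // => i j /minj[].
have -> : f @: [set: H] = f @: (~: B)%SET.
  apply/setP => z; apply/imsetP/imsetP => -[x _ ->]; last by exists x.
  have [/imsetP[i _ ->]|xB] := boolP (x \in B); last first.
    by exists x; rewrite // finset.in_setC.
  exists (m (i, false)); rewrite // finset.in_setC.
  by apply/imsetP => -[j _ /minj[]].
by rewrite (leq_trans (leq_imset_card _ _)) // cardsCs finset.setCK cB.
Qed.

Lemma copy_code (H : simple_graph) k (s : strategy) (N : nat) (w : N.-tuple bool) :
  (0 < k)%N -> has_matching H k -> has_copy H (built s w) ->
  exists (r : {ffun H -> 'I_(#|H| - k)}) (g : {ffun 'I_(#|H| - k) -> 'I_N})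
    (sigma : {ffun H -> bool}) (C : {set {set H}}),
    (#|edges H| - k * k.-1 <= #|C|)%N /\
    code_event s N (fun x => g (r x)) sigma C w.
Proof.
move=> k0 Hk [f [finj fcopy]].
have edge_time A : A \in edges H -> exists i : 'I_N, nth false w i /\
    exists x y, A = [set x; y]%SET /\ s (take i w) = (f x, f y).
  case/edgesP => x [y [/fcopy xy ->]].
  case/orP: xy => /built_query[i]; rewrite size_tuple => iN [wi qi].
    by exists (Ordinal iN); split=> //; exists x, y.
  by exists (Ordinal iN); split=> //; exists y, x; rewrite finset.setUC.
have [m0 m0P] := has_matchingP Hk.
(* As [k > 0], some edge was queried; its time is the default for non-edges and isolated
   vertices. *)
have [i0 _] := edge_time _ (medge_edges (Ordinal k0) m0P).
have /choice[T TP] A : exists i : 'I_N, A \in edges H -> nth false w i /\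
    exists x y, A = [set x; y]%SET /\ s (take i w) = (f x, f y).
  by case: (boolP (A \in edges H)) => [/edge_time[i ?]|_]; [exists i|exists i0].
have side A x : A \in edges H -> x \in A -> exists b : bool,
    (if b then (s (take (T A) w)).1 else (s (take (T A) w)).2) = f x.
  case/TP=> _ [y [z [-> ->]]]; rewrite !inE => /orP[] /eqP ->.
    by exists true.
  by exists false.
have [m [mP swap1 swap2]] := min_weight_matching (fun A => val (T A)) Hk.
have adjE x y : adj x y -> [set x; y]%SET \in edges H.
  by move=> xy; apply/edgesP; exists x, y.
(* The time and side locating [x]: from its matching edge, or else from the earliest edge at [x].
   For isolated [x] the value is arbitrary, as no edge of [C] contains [x]. *)
have /choice[ts tsP] x : exists ts : 'I_N * bool,
  [/\ forall i b, m (i, b) = x -> ts.1 = T (medge m i),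
      (forall z, m z != x) -> forall y, adj x y -> (ts.1 <= T [set x; y]%SET)%N &
      (exists y, adj x y) ->
        (if ts.2 then (s (take ts.1 w)).1 else (s (take ts.1 w)).2) = f x].
  have [/codomP[[i b] xE]|xm] := boolP (x \in codom m).
    have [c cP] : exists c : bool, (if c then (s (take (T (medge m i)) w)).1
        else (s (take (T (medge m i)) w)).2) = f x.
      apply: side; first exact: medge_edges.
      by rewrite xE (medgeE m i b) set21.
    exists (T (medge m i), c); split=> //= [j d|/(_ (i, b))]; last by rewrite xE eqxx.
    by case/andP: mP => /injectiveP minj _; rewrite xE => /minj[-> _].
  have nm i b : m (i, b) <> x.
    by move=> e; rewrite -e codom_f in xm.
  case: (pickP (adj x)) => [y0 xy0|nadj]; last first.
    exists (i0, true); split=> [i b /nm //|_ y|[y]]; by rewrite nadj.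
  case: (arg_minnP (fun y => val (T [set x; y]%SET)) xy0) => y xy ymin.
  have [c cP] := side _ x (adjE _ _ xy) (set21 _ _).
  by exists (T [set x; y]%SET, c); split=> // i b /nm.
have [r [g grE]] : exists (r : {ffun H -> 'I_(#|H| - k)})
    (g : {ffun 'I_(#|H| - k) -> 'I_N}), forall x, g (r x) = (ts x).1.
  apply: (factor_card i0 (f := fun x => (ts x).1)).
  apply: (matching_imset_card mP) => i.
  have [/(_ i true erefl) -> _ _] := tsP (m (i, true)).
  by have [/(_ i false erefl) ->] := tsP (m (i, false)).
pose tau x : nat := (ts x).1.
have tau_gr : (fun x => g (r x) : nat) = tau by apply/funext => x; rewrite grE.
exists r, g, [ffun x => (ts x).2], (counted (fun A => val (T A)) tau).
rewrite tau_gr; split.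
  apply: (card_counted mP swap1 swap2) => [i b|x xm y xy].
    by have [/(_ i b erefl) e _ _] := tsP (m (i, b)); rewrite /tau e.
  by have [_ + _] := tsP x; apply.
have imageE A x : A \in counted (fun A => val (T A)) tau -> x \in A ->
    vertex_image s tau [ffun x => (ts x).2] w x = f x.
  rewrite finset.in_set => /andP[/edgesP[y [z [yz ->]]] _] xyz.
  rewrite /vertex_image ffunE; have [_ _ -> //] := tsP x.
  move: xyz; rewrite !inE => /orP[] /eqP ->; first by exists z.
  by exists y; rewrite adj_sym.
apply/andP; split.
  apply/forall_inP => A AC; apply/forall_inP => B BC.
  apply/forall_inP => x xA; apply/forall_inP => y yB.
  by rewrite (imageE A) // (imageE B) // (inj_eq finj) implybb.
apply/forall_inP => A AC; apply/existsP; exists (T A).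
have := AC; rewrite finset.in_set => /andP[AE /forall_inP Atau].
have [-> [x [y [Axy qT]]]] := TP _ AE.
have xA : x \in A by rewrite Axy set21.
have yA : y \in A by rewrite Axy set22.
apply/askedP; exists x, y; split; rewrite ?Atau //.
by rewrite !(imageE A).
Qed.

(** * Union bound and conclusion *)

Lemma card_set_type (T : finType) : #|{: {set T}}| = (2 ^ #|T|)%N.
Proof. by have := card_powerset [set: T]%SET; rewrite powersetT !cardsT. Qed.

(* Bounds the number of encodings [(r, g, sigma, C)], the factor [N ^ (#|H| - k)]
   for [g] being left out. *)
Definition code_const (H : simple_graph) : nat :=
  (#|H| ^ #|H| * 2 ^ #|H| * 2 ^ 2 ^ #|H|)%N.

Lemma code_const_gt0 (H : simple_graph) : (0 < code_const H)%N.
Proof. by rewrite /code_const !muln_gt0 !expn_gt0 /= !andbT orbC; case: #|H|. Qed.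

Lemma win_prob_le (R : realType) (H : simple_graph) k (p : R) (s : strategy) (N : nat) :
  (0 < k)%N -> has_matching H k -> 0 <= p <= 1 -> legal s ->
  win_prob H p s N <=
  (code_const H * N ^ (#|H| - k))%:R * p ^+ (#|edges H| - k * k.-1).
Proof.
move=> k0 Hk p01 sl; have /andP[p0 p1] := p01.
set d := (#|H| - k)%N; set e := (#|edges H| - k * k.-1)%N.
pose code : finType := ({ffun H -> 'I_d} * {ffun 'I_d -> 'I_N} *
  {ffun H -> bool} * {set {set H}})%type.
pose ev (c : code) (w : N.-tuple bool) : bool := (e <= #|c.2|)%N &&
  code_event s N (fun x => c.1.1.2 (c.1.1.1 x)) c.1.2 c.2 w.
have cardc : (#|{: code}| <= code_const H * N ^ d)%N.
  rewrite !card_prod !card_ffun !card_ord card_bool !card_set_type.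
  rewrite -!mulnA (mulnC (N ^ d)%N) /code_const !mulnA !leq_mul2r.
  do 3![apply/orP; right].
  by have [->|H0] := posnP #|H|; rewrite // leq_exp2r // leq_subr.
apply: (@le_trans _ _ (\sum_(w : N.-tuple bool) \sum_(c : code | ev c w)
    bern_weight p w)).
  rewrite /win_prob big_mkcond /=; apply: ler_sum => w _.
  case: asboolP => [/(copy_code k0 Hk)[r [g [sg [C [eC evC]]]]]|_]; last first.
    by apply: sumr_ge0 => c _; apply: bern_weight_ge0.
  rewrite (bigD1 (r, g, sg, C)) /=; last by rewrite /ev /= eC.
  by rewrite lerDl; apply: sumr_ge0 => c _; apply: bern_weight_ge0.
rewrite (exchange_big_dep predT) //=.
apply: (@le_trans _ _ (\sum_(c : code) p ^+ e)); last first.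
  by rewrite sumr_const -[leLHS]mulr_natl ler_wpM2r ?exprn_ge0 // ler_nat.
apply: ler_sum => c _; have [ec|ec] := boolP (e <= #|c.2|)%N; last first.
  by rewrite big_pred0 ?exprn_ge0 // => w; rewrite /ev (negPf ec).
under eq_bigl do rewrite /ev ec /=.
apply: le_trans (code_event_prob _ _ _ _ p01 sl) _.
by rewrite ler_wiXn2l.
Qed.

Theorem theorem12 (R : realType) (H : simple_graph) :
  exists c : R, 0 < c /\
    forall (k : nat) (p : R),
      (1 <= k)%N -> has_matching H k -> 0 < p -> p < 1 ->
      ((c * p `^ (- ((#|edges H|%:R - k%:R * (k%:R - 1)) / (#|H|%:R - k%:R))))%:E
         <= query_number H p)%E.
Proof.
(* Chosen so that [code_const H] times [c] is one half, the required winning probability. *)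
pose c : R := (2 * (code_const H)%:R)^-1.
have A0 : 1 <= (code_const H)%:R :> R by rewrite ler1n code_const_gt0.
have c0 : 0 < c by rewrite invr_gt0 mulr_gt0 // (lt_le_trans _ A0).
have c1 : c <= 1.
  by rewrite invf_le1 ?mulr_gt0 ?(lt_le_trans _ A0) // mulr_ege1 // ler1n.
exists c; split=> // k p k0 Hk p0 p1.
apply: le_ereal_inf_tmp => _ [N [s [sl win]] <-]; rewrite lee_fin.
have [m mP] := has_matchingP Hk; have k2 := matching_card mP.
set d := (#|H| - k)%N; set e := (#|edges H| - k * k.-1)%N.
have d0 : (0 < d)%N by rewrite /d; lia.
have dR : d%:R = #|H|%:R - k%:R :> R by rewrite natrB //; lia.
rewrite -dR; set mu := _ - _ * _.
(* Truncated subtraction can only raise the exponent, and for [p < 1] this strengthens the lower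
   bound to be proved. *)
have mu_e : mu <= e%:R.
  rewrite /mu lerBlDr -[k%:R - 1](@natrB _ k 1) // -natrM -natrD ler_nat /e subn1.
  lia.
have d0R : 0 < d%:R :> R by rewrite ltr0n.
apply: (@le_trans _ _ (c * p `^ (- (e%:R / d%:R)))).
  apply: ler_wpM2l; first exact: ltW.
  apply: ger_powR; first by rewrite p0 ltW.
  by rewrite lerN2 ler_pM2r // invr_gt0.
rewrite leNgt; apply/negP => lt.
have p01 : 0 <= p <= 1 by rewrite !ltW.
have := le_trans win (win_prob_le N k0 Hk p01 sl); rewrite -/d -/e leNgt => /negP.
apply; set y := p `^ _ in lt.
have pe0 : 0 < p ^+ e by rewrite exprn_gt0.
have yd : y ^+ d = (p ^+ e)^-1.
  rewrite -powR_mulrn ?powR_ge0 // /y -powRrM mulNr divfK ?gt_eqF //.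
  by rewrite powRN powR_mulrn // ltW.
(* Raising [N < c * y] to the power [d] gives [c ^+ d], at most [c] because [c <= 1] and [d > 0]; so
   [c] need not depend on [k]. *)
have Nd : N%:R ^+ d < c * (p ^+ e)^-1.
  apply: (@lt_le_trans _ _ ((c * y) ^+ d)).
    by rewrite ltrXn2r ?ler0n // -lt0n.
  rewrite exprMn yd; apply: ler_wpM2r; first by rewrite invr_ge0 ltW.
  by apply: ler_iXnr => //; exact: ltW.
rewrite natrM natrX.
apply: (@lt_le_trans _ _ ((code_const H)%:R * (c * (p ^+ e)^-1) * p ^+ e)).
  by rewrite ltr_pM2r // ltr_pM2l // (lt_le_trans _ A0).
rewrite mulrA mulfVK ?gt_eqF // /c.
have A1 : (code_const H)%:R != 0 :> R by rewrite gt_eqF // (lt_le_trans _ A0).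
by rewrite invfM mulrCA divff // mulr1 mul1r.
Qed.
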